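(* Let $\phi$ be a first-order formula (in some first-order language) with bound variables $y_1,\dots,y_k$ and free variables $x_1,\dots,x_m$, and let $\Delta_1,\dots,\Delta_s$ be the connected components of the graph $\Delta(\phi)$. Then $\phi$ is equivalent to a formula $\phi'$ with connected graph $\Delta(\phi')$ such that $$|\Delta(\phi')|\leqslant\max(|\Delta_1|,\dots,|\Delta_s|).$$
   Context: For a first-order formula $\phi$, the graph $\Delta(\phi)$ has as vertices the bound variables of $\phi$; two vertices $y_i$ and $y_j$ are connected by an edge if there exists an atomic subformula of $\phi$ containing both variables. $|\cdot|$ denotes the number of vertices of a graph. Equivalence means logical equivalence (the formulae are satisfied by the same tuples in every structure; structures are nonempty). Free and bound variables of $\phi$ are different symbols. *)

(* Defs.v *)
From HB Require Import structures.
From mathcomp Require Import all_boot.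

Set Implicit Arguments.
Unset Strict Implicit.
Unset Printing Implicit Defensive.

(* [has_eq] tells whether the language has equality as a logical symbol, so
   that languages with and without equality are both covered. *)
Record language : Type := Language {
  fun_symb : Type;
  fun_arity : fun_symb -> nat;
  rel_symb : Type;
  rel_arity : rel_symb -> nat;
  has_eq : bool
}.

(* Variable symbols are natural numbers. *)
Inductive term (L : language) : Type :=
| Var of nat
| App (f : fun_symb L) of 'I_(fun_arity f) -> term L.

Inductive atom (L : language) : Type :=
| AEq of has_eq L & term L & term L
| ARel (r : rel_symb L) of 'I_(rel_arity r) -> term L.

Inductive formula (L : language) : Type :=
| Atom of atom L
| Not of formula L
| And of formula L & formula L
| Or of formula L & formula L
| Imp of formula L & formula L
| All of nat & formula L
| Ex of nat & formula L.

Record structure (L : language) : Type := Structure {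
  carrier :> Type;
  carrier_nonempty : inhabited carrier;
  fun_interp : forall f : fun_symb L, (fun_arity f).-tuple carrier -> carrier;
  rel_interp : forall r : rel_symb L, (rel_arity r).-tuple carrier -> Prop
}.

Section Semantics.
Variables (L : language) (M : structure L).

Fixpoint eval (rho : nat -> M) (t : term L) : M :=
  match t with
  | Var x => rho x
  | App f args => fun_interp [tuple eval rho (args i) | i < fun_arity f]
  end.

Definition sat_atom (rho : nat -> M) (a : atom L) : Prop :=
  match a with
  | AEq _ t1 t2 => eval rho t1 = eval rho t2
  | ARel r args => rel_interp [tuple eval rho (args i) | i < rel_arity r]
  end.

Definition update (rho : nat -> M) (y : nat) (m : M) : nat -> M :=
  fun z => if z == y then m else rho z.

Fixpoint sat (rho : nat -> M) (phi : formula L) : Prop :=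
  match phi with
  | Atom a => sat_atom rho a
  | Not p => ~ sat rho p
  | And p q => sat rho p /\ sat rho q
  | Or p q => sat rho p \/ sat rho q
  | Imp p q => sat rho p -> sat rho q
  | All y p => forall m : M, sat (update rho y m) p
  | Ex y p => exists m : M, sat (update rho y m) p
  end.

End Semantics.

Definition equivalent (L : language) (phi psi : formula L) : Prop :=
  forall (M : structure L) (rho : nat -> M), sat rho phi <-> sat rho psi.

Section Syntax.
Variable L : language.

Fixpoint term_vars (t : term L) : seq nat :=
  match t with
  | Var x => [:: x]
  | App f args => flatten [seq term_vars (args i) | i <- enum 'I_(fun_arity f)]
  end.

Definition atom_vars (a : atom L) : seq nat :=
  match a with
  | AEq _ t1 t2 => term_vars t1 ++ term_vars t2
  | ARel r args => flatten [seq term_vars (args i) | i <- enum 'I_(rel_arity r)]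
  end.

Fixpoint atoms (phi : formula L) : seq (atom L) :=
  match phi with
  | Atom a => [:: a]
  | Not p => atoms p
  | And p q | Or p q | Imp p q => atoms p ++ atoms q
  | All _ p | Ex _ p => atoms p
  end.

Fixpoint free_vars (phi : formula L) : seq nat :=
  match phi with
  | Atom a => atom_vars a
  | Not p => free_vars p
  | And p q | Or p q | Imp p q => free_vars p ++ free_vars q
  | All y p | Ex y p => [seq x <- free_vars p | x != y]
  end.

(* A bound variable is a quantified symbol: a symbol quantified several times
   in a formula is a single bound variable of that formula. *)
Fixpoint bound_vars (phi : formula L) : seq nat :=
  match phi with
  | Atom _ => [::]
  | Not p => bound_vars p
  | And p q | Or p q | Imp p q => bound_vars p ++ bound_vars q
  | All y p | Ex y p => y :: bound_vars p
  end.

Definition free_bound_disjoint (phi : formula L) : Prop :=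
  forall x : nat, x \in free_vars phi -> x \notin bound_vars phi.

(* [seq_sub s] is the finite type of the elements of [s], repetitions in [s]
   being immaterial. *)
Definition Delta_vertex (phi : formula L) : finType := seq_sub (bound_vars phi).

Definition Delta_edge (phi : formula L) : rel (Delta_vertex phi) :=
  fun u v => (u != v) &&
    has (fun a => (val u \in atom_vars a) && (val v \in atom_vars a))
        (atoms phi).

Definition Delta_components (phi : formula L) : {set {set Delta_vertex phi}} :=
  equivalence_partition (connect (@Delta_edge phi)) [set: Delta_vertex phi].

(* The empty graph (that of a quantifier-free formula) counts as connected. *)
Definition Delta_connected (phi : formula L) : Prop :=
  forall u v : Delta_vertex phi, connect (@Delta_edge phi) u v.

End Syntax.

(* Main.v *)
Require Import Defs.
From HB Require Import structures.
From mathcomp Require Import all_boot.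
From Stdlib Require Import Classical.

Set Implicit Arguments.
Unset Strict Implicit.
Unset Printing Implicit Defensive.

(** Every atom contains bound variables of at most one component of the graph.
    Putting the scope of each quantifier in disjunctive normal form and pulling
    out of it the conjuncts of the other components turns the formula into a
    boolean combination of formulas, each with bound variables from a single
    component. The normal forms are taken without simplification, so no atom is
    lost and the constants true and false never appear. One may then rename
    the bound variables of each component injectively into those of a largest
    one, [C0], keeping [C0] itself fixed. All bound variables now lie in [C0],
    and the atoms that connected [C0] are still there. *)

(** * Equivalences that lose no co-occurrence of variables *)

Section Refinement.
Variable L : language.
Implicit Types p q r : formula L.

(** The edge relation without [x != y], stated on variable symbols so that formulas with different
    vertex types can be compared. *)
Definition cooccur p (x y : nat) : bool :=
  has (fun a => (x \in atom_vars a) && (y \in atom_vars a)) (atoms p).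

(** Variables may only disappear and co-occurring pairs may only be added: no new vertex arises, and
    edges between surviving vertices persist. *)
Definition refines p q : Prop :=
  [/\ equivalent p q,
      {subset free_vars q <= free_vars p},
      {subset bound_vars q <= bound_vars p} &
      forall x y, cooccur p x y -> cooccur q x y].

Lemma refines_refl p : refines p p.
Proof. by split. Qed.

Lemma refines_trans {q p r} : refines p q -> refines q r -> refines p r.
Proof.
move=> [e1 f1 b1 c1] [e2 f2 b2 c2]; split.
- by move=> M rho; rewrite (e1 M rho).
- by move=> x /f2/f1.
- by move=> x /b2/b1.
- by move=> x y /c1/c2.
Qed.

Lemma refines_not {p p'} : refines p p' -> refines (Not p) (Not p').
Proof. by move=> [e f b c]; split=> // M rho /=; rewrite (e M rho). Qed.

Lemma refines_and {p p' q q'} :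
  refines p p' -> refines q q' -> refines (And p q) (And p' q').
Proof.
move=> [e1 f1 b1 c1] [e2 f2 b2 c2]; split.
- by move=> M rho /=; rewrite (e1 M rho) (e2 M rho).
- by move=> x /=; rewrite !mem_cat => /orP[/f1|/f2] ->; rewrite ?orbT.
- by move=> x /=; rewrite !mem_cat => /orP[/b1|/b2] ->; rewrite ?orbT.
- move=> x y; rewrite /cooccur /= !has_cat.
  by case/orP=> [/c1|/c2]; rewrite /cooccur => ->; rewrite ?orbT.
Qed.

Lemma refines_or {p p' q q'} :
  refines p p' -> refines q q' -> refines (Or p q) (Or p' q').
Proof.
move=> rp rq; have [_ f b c] := refines_and rp rq; split=> //.
by case: rp rq => [e1 _ _ _] [e2 _ _ _] M rho /=; rewrite (e1 M rho) (e2 M rho).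
Qed.

Lemma refines_ex {y p p'} : refines p p' -> refines (Ex y p) (Ex y p').
Proof.
move=> [e f b c]; split.
- by move=> M rho /=; split=> -[m Hm]; exists m; apply/e.
- by move=> x /=; rewrite !mem_filter => /andP[-> /f].
- by move=> x /=; rewrite !inE => /orP[->//|/b ->]; rewrite orbT.
- exact: c.
Qed.

(** Settles the inclusions of variables and of co-occurring pairs by cases on membership, leaving
    the semantic clause. *)
Ltac bookkeeping :=
  try (by move=> x /=; rewrite ?(mem_cat, mem_filter, inE);
       repeat case: (_ \in _) => //=; repeat case: (_ == _));
  try (by move=> x y; rewrite /cooccur /= ?has_cat;
       repeat case: (has _ _)).

Lemma refines_and_orl p q r :
  refines (And (Or p q) r) (Or (And p r) (And q r)).
Proof. by split; bookkeeping; move=> M rho /=; tauto. Qed.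

Lemma refines_andC p q : refines (And p q) (And q p).
Proof. by split; bookkeeping; move=> M rho /=; tauto. Qed.

Lemma refines_andA p q r : refines (And p (And q r)) (And (And p q) r).
Proof. by split; bookkeeping; move=> M rho /=; tauto. Qed.

Lemma refines_andAr p q r : refines (And (And p q) r) (And p (And q r)).
Proof. by split; bookkeeping; move=> M rho /=; tauto. Qed.

Lemma refines_andACA p q r s :
  refines (And (And p q) (And r s)) (And (And p r) (And q s)).
Proof. by split; bookkeeping; move=> M rho /=; tauto. Qed.

Lemma refines_not_and p q : refines (Not (And p q)) (Or (Not p) (Not q)).
Proof.
by split; bookkeeping; move=> M rho /=; have := classic (sat rho p); tauto.
Qed.

Lemma refines_not_or p q : refines (Not (Or p q)) (And (Not p) (Not q)).
Proof. by split; bookkeeping; move=> M rho /=; tauto. Qed.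

Lemma refines_imp p q : refines (Imp p q) (Or (Not p) q).
Proof.
by split; bookkeeping; move=> M rho /=; have := classic (sat rho p); tauto.
Qed.

Lemma refines_all y p : refines (All y p) (Not (Ex y (Not p))).
Proof.
split; bookkeeping; move=> M rho /=; split=> [H [m]|H m]; first exact.
by apply: NNPP => Hm; apply: H; exists m.
Qed.

Lemma refines_ex_or y p q : refines (Ex y (Or p q)) (Or (Ex y p) (Ex y q)).
Proof.
split; bookkeeping; move=> M rho /=; split.
  by case=> m [] Hm; [left|right]; exists m.
by case=> -[m Hm]; exists m; [left|right].
Qed.

Lemma eq_eval (M : structure L) (rho rho' : nat -> M) (t : term L) :
  {in term_vars t, rho =1 rho'} -> eval rho t = eval rho' t.
Proof.
elim: t => [x|f args IH] /= H; first by apply: H; rewrite mem_head.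
congr fun_interp; apply: eq_mktuple => i; apply: IH => x xi; apply: H.
by apply/flatten_mapP; exists i; rewrite ?mem_enum.
Qed.

Lemma eq_sat (M : structure L) p (rho rho' : nat -> M) :
  {in free_vars p, rho =1 rho'} -> sat rho p <-> sat rho' p.
Proof.
elim: p rho rho' => [a|p IH|p IHp q IHq|p IHp q IHq|p IHp q IHq|y p IH|y p IH]
  rho rho' /= H.
- case: a H => [h s t|R args] /= H.
    by rewrite (@eq_eval M rho rho' s) ?(@eq_eval M rho rho' t) // => x Hx;
      apply: H; rewrite mem_cat Hx ?orbT.
  suff -> : [tuple eval rho (args i) | i < rel_arity R]
          = [tuple eval rho' (args i) | i < rel_arity R] by [].
  apply: eq_mktuple => i; apply: eq_eval => x xi; apply: H.
  by apply/flatten_mapP; exists i; rewrite ?mem_enum.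
- by rewrite (IH rho rho').
1-3: by rewrite (IHp rho rho') ?(IHq rho rho') // => x Hx; apply: H;
        rewrite mem_cat Hx ?orbT.
all: have Hm m : sat (update rho y m) p <-> sat (update rho' y m) p
  by apply: IH => x Hx; rewrite /update; case: eqVneq => // ne;
     apply: H; rewrite mem_filter ne.
- by split=> H' m; apply/Hm.
- by split=> -[m H']; exists m; apply/Hm.
Qed.

Lemma sat_update (M : structure L) p (rho : nat -> M) y m :
  y \notin free_vars p -> sat (update rho y m) p <-> sat rho p.
Proof.
move=> yp; apply: eq_sat => x xp; rewrite /update.
by case: eqVneq => // xy; rewrite -xy xp in yp.
Qed.

Lemma refines_ex_vacuous y p : y \notin free_vars p -> refines (Ex y p) p.
Proof.
move=> yp; split=> //.
- move=> M rho /=; split=> [[m /(sat_update _ _ yp)]//|Hp].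
  (* A witness for the vacuous quantifier exists because structures are nonempty. *)
  by case: (carrier_nonempty M) => m; exists m; apply/sat_update.
- move=> x xp /=; rewrite mem_filter xp andbT.
  by apply: contraNneq yp => <-.
- by move=> x xp /=; rewrite inE xp orbT.
Qed.

Lemma refines_ex_andr y p q :
  y \notin free_vars q -> refines (Ex y (And p q)) (And (Ex y p) q).
Proof.
move=> yq; split; bookkeeping.
  move=> M rho /=; split.
    by case=> m [Hp /(sat_update _ _ yq) Hq]; split=> //; exists m.
  by case=> -[m Hp] Hq; exists m; split=> //; apply/sat_update.
(* A free variable of [q] differs from [y], so the quantifier on the left does not remove it. *)
move=> x /=; rewrite !(mem_cat, mem_filter) => /orP[/andP[-> ->]//|xq].
by rewrite xq orbT andbT; apply: contraNneq yq => <-.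
Qed.

End Refinement.

(** * Disjunctive normal form by colours *)

Section Separation.
Variables (L : language) (T : eqType).

(* The variables bound in the ambient formula are coloured by their component;
   [None] marks the other ones, which are compatible with all colours. *)
Variable colour : nat -> option T.
Implicit Types p q : formula L.

(** Bound variables are included because a renaming must be injective on them too. *)
Definition vars p : seq nat := free_vars p ++ bound_vars p.

Definition monochrome (k : T) p : Prop :=
  {in vars p, forall x, colour x = None \/ colour x = Some k}.

(** Monochrome formulas of any inner shape play the role of literals; the colour [k] may change from
    one conjunct to the next. *)
Inductive conj_form : formula L -> Prop :=
| conj_mono k p of monochrome k p : conj_form p
| conj_and p q of conj_form p & conj_form q : conj_form (And p q).

Inductive disj_form : formula L -> Prop :=
| disj_conj p of conj_form p : disj_form p
| disj_or p q of disj_form p & disj_form q : disj_form (Or p q).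

Definition separable p : Prop := exists2 q, refines p q & disj_form q.

Lemma separable_refines {p q} : refines p q -> separable q -> separable p.
Proof. by move=> pq [r qr dr]; exists r => //; apply: refines_trans qr. Qed.

Lemma separable_disj p : disj_form p -> separable p.
Proof. by exists p => //; apply: refines_refl. Qed.

Lemma separable_or p q : separable p -> separable q -> separable (Or p q).
Proof.
by move=> [p' pp' dp] [q' qq' dq]; exists (Or p' q'); [apply: refines_or|right].
Qed.

Lemma separable_and p q : separable p -> separable q -> separable (And p q).
Proof.
move=> [p' pp' dp] [q' qq' dq].
apply: (separable_refines (refines_and pp' qq')) => {p q pp' qq'}.
elim: dp => {p'} [p cp|p1 p2 _ IH1 _ IH2]; last first.
  apply: (separable_refines (refines_and_orl _ _ _)); exact: separable_or.
elim: dq => {q'} [q cq|q1 q2 _ IH1 _ IH2].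
  by apply: separable_disj; left; right.
(* Distributivity is available on the left only: swap, distribute, and swap back in each
   disjunct. *)
apply: (separable_refines (refines_andC _ _)).
apply: (separable_refines (refines_and_orl _ _ _)).
by apply: separable_or; apply: (separable_refines (refines_andC _ _)).
Qed.

(** De Morgan's laws push the negation down to the monochrome pieces, whose negations are
    monochrome; the result is distributed again. *)
Lemma separable_not p : separable p -> separable (Not p).
Proof.
move=> [p' pp' dp]; apply: (separable_refines (refines_not pp')) => {p pp'}.
elim: dp => {p'} [p cp|p q _ IHp _ IHq]; last first.
  by apply: (separable_refines (refines_not_or _ _)); apply: separable_and.
elim: cp => {p} [k p mp|p q _ IHp _ IHq].
  by apply: separable_disj; left; apply: (@conj_mono k).
by apply: (separable_refines (refines_not_and _ _)); apply: separable_or.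
Qed.

(** Conjuncts of colour [k] are gathered on the left and those without [y] on the right. Without
    truth constants an empty side cannot be written, hence three cases. *)
Lemma conj_form_split k y p : colour y = Some k -> conj_form p ->
  [\/ exists2 q, refines p q & monochrome k q,
      exists2 q, refines p q & conj_form q /\ y \notin free_vars q |
      exists q r, [/\ refines p (And q r), monochrome k q,
                      conj_form r & y \notin free_vars r]].
Proof.
move=> ck; elim=> {p} [l p mp|p1 p2 _ IH1 _ IH2].
  case: (eqVneq l k) => [<-|ne].
    by constructor 1; exists p => //; apply: refines_refl.
  constructor 2; exists p; first exact: refines_refl.
  split; first exact: conj_mono mp.
  (* A piece of colour [l] different from [k] cannot contain [y], which has colour [k]. *)
  apply/negP => yp; have := mp y; rewrite ck mem_cat yp => /(_ isT)[//|[kl]].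
  by rewrite kl eqxx in ne.
have mono_and q q' : monochrome k q -> monochrome k q' ->
    monochrome k (And q q').
  move=> mq mq' x; rewrite /vars /= !mem_cat.
  by case/orP=> /orP[] H; [apply: mq|apply: mq'|apply: mq|apply: mq'];
     rewrite mem_cat H ?orbT.
have notin_and q q' : y \notin free_vars q -> y \notin free_vars q' ->
    y \notin free_vars (And q q').
  by move=> yq yq'; rewrite mem_cat negb_or yq.
case: IH1 => [[q1 r1 m1]|[q1 r1 [c1 y1]]|[q1 [s1 [r1 m1 c1 y1]]]];
  case: IH2 => [[q2 r2 m2]|[q2 r2 [c2 y2]]|[q2 [s2 [r2 m2 c2 y2]]]];
  have r12 := refines_and r1 r2.
- by constructor 1; exists (And q1 q2) => //; apply: mono_and.
- by constructor 3; exists q1, q2.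
- constructor 3; exists (And q1 q2), s2; split=> //; last exact: mono_and.
  by apply: refines_trans r12 _; apply: refines_andA.
- constructor 3; exists q2, q1; split=> //.
  by apply: refines_trans r12 _; apply: refines_andC.
- constructor 2; exists (And q1 q2) => //; split; last exact: notin_and.
  exact: conj_and.
- constructor 3; exists q2, (And s2 q1); split=> //; last exact: notin_and.
    apply: refines_trans r12 _; apply: refines_trans (refines_andC _ _) _.
    exact: refines_andAr.
  exact: conj_and.
- constructor 3; exists (And q2 q1), s1; split=> //; last exact: mono_and.
  apply: refines_trans r12 _; apply: refines_trans (refines_andC _ _) _.
  exact: refines_andA.
- constructor 3; exists q1, (And s1 q2); split=> //; last exact: notin_and.
    by apply: refines_trans r12 _; apply: refines_andAr.
  exact: conj_and.
- constructor 3; exists (And q1 q2), (And s1 s2); split=> //.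
  + by apply: refines_trans r12 _; apply: refines_andACA.
  + exact: mono_and.
  + exact: conj_and.
  + exact: notin_and.
Qed.

(** The quantifier distributes over the disjuncts. In each one, the conjuncts without [y] leave the
    scope; what stays has the colour of [y], so quantifying it keeps it monochrome. If nothing
    stays, the quantifier is vacuous. *)
Lemma separable_ex y p : colour y != None -> separable p -> separable (Ex y p).
Proof.
case ck: (colour y) => [k|] // _ [p' pp' dp].
apply: (separable_refines (refines_ex pp')) => {p pp'}.
have mono_ex q : monochrome k q -> monochrome k (Ex y q).
  move=> mq x; rewrite /vars /= mem_cat mem_filter inE.
  case: eqVneq => [-> _|_ xq]; first by right.
  by apply: mq; rewrite mem_cat.
elim: dp => {p'} [p cp|p q _ IHp _ IHq]; last first.
  by apply: (separable_refines (refines_ex_or _ _ _)); apply: separable_or.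
case: (conj_form_split ck cp) =>
  [[q pq mq]|[q pq [cq yq]]|[q [r [pqr mq cr yr]]]].
- apply: (separable_refines (refines_ex pq)); apply: separable_disj.
  by left; apply: conj_mono (mono_ex _ mq).
- apply: (separable_refines (refines_ex pq)).
  apply: (separable_refines (refines_ex_vacuous yq)).
  by apply: separable_disj; left.
- apply: (separable_refines (refines_ex pqr)).
  apply: (separable_refines (refines_ex_andr _ yr)).
  apply: separable_disj; left; right=> //.
  exact: conj_mono (mono_ex _ mq).
Qed.

(** Atoms are monochrome because no atom mixes colours; [k0] serves for atoms without coloured
    variables. Implications and universal quantifiers are first rewritten through negation. *)
Lemma separableP (k0 : T) p :
  {in bound_vars p, forall y, colour y != None} ->
  (forall x y, cooccur p x y -> colour x != None -> colour y != None ->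
     colour x = colour y) ->
  separable p.
Proof.
elim: p => [a|p IH|p IHp q IHq|p IHp q IHq|p IHp q IHq|y p IH|y p IH] B C.
- have [k ck] : exists k, {in atom_vars a, forall x,
      colour x = None \/ colour x = Some k}.
    case: (boolP (has (fun x => colour x != None) (atom_vars a))).
      case/hasP=> x xa; case cx: (colour x) => [k|//] _; exists k => z za.
      case cz: (colour z) => [l|]; [right|by left].
      by rewrite -cz -cx (C x z) ?cx ?cz //; rewrite /cooccur /= xa za.
    move/hasPn=> H; exists k0 => x /H; rewrite negbK => /eqP; by left.
  apply: separable_disj; left; apply: (@conj_mono k) => x.
  by rewrite /vars cats0 => /ck.
- by apply: separable_not; apply: IH.
1-3: have Sp : separable p
  by apply: IHp => [x Hx|x y Hxy]; [apply: B|apply: C];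
     rewrite /= ?mem_cat ?Hx // /cooccur /= has_cat; apply/orP; left.
1-3: have Sq : separable q
  by apply: IHq => [x Hx|x y Hxy]; [apply: B|apply: C];
     rewrite /= ?mem_cat ?Hx ?orbT // /cooccur /= has_cat; apply/orP; right.
- exact: separable_and.
- exact: separable_or.
- apply: (separable_refines (refines_imp _ _)).
  by apply: separable_or => //; apply: separable_not.
all: have Sp : separable p
  by apply: IH => // x Hx; apply: B; rewrite inE Hx orbT.
all: have cy : colour y != None by apply: B; rewrite mem_head.
- apply: (separable_refines (refines_all _ _)); apply: separable_not.
  by apply: separable_ex => //; apply: separable_not.
- exact: separable_ex.
Qed.

End Separation.

(** * Renaming of variables *)

Section Renaming.
Variables (L : language) (f : nat -> nat).
Implicit Types p q : formula L.

Fixpoint rename_term (t : term L) : term L :=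
  match t with
  | Var x => Var L (f x)
  | App g args => App (fun i => rename_term (args i))
  end.

Definition rename_atom (a : atom L) : atom L :=
  match a with
  | AEq h s t => AEq h (rename_term s) (rename_term t)
  | ARel R args => ARel (fun i => rename_term (args i))
  end.

Fixpoint rename p : formula L :=
  match p with
  | Atom a => Atom (rename_atom a)
  | Not p => Not (rename p)
  | And p q => And (rename p) (rename q)
  | Or p q => Or (rename p) (rename q)
  | Imp p q => Imp (rename p) (rename q)
  | All y p => All (f y) (rename p)
  | Ex y p => Ex (f y) (rename p)
  end.

Lemma term_vars_rename t : term_vars (rename_term t) = map f (term_vars t).
Proof.
elim: t => [//|g args IH] /=; rewrite map_flatten -map_comp.
by congr flatten; apply: eq_map => i /=.
Qed.

Lemma atom_vars_rename a : atom_vars (rename_atom a) = map f (atom_vars a).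
Proof.
case: a => [h s t|R args] /=; first by rewrite map_cat !term_vars_rename.
rewrite map_flatten -map_comp.
by congr flatten; apply: eq_map => i /=; rewrite term_vars_rename.
Qed.

Lemma bound_vars_rename p : bound_vars (rename p) = map f (bound_vars p).
Proof.
by elim: p => //= [p -> q ->|p -> q ->|p -> q ->|y p ->|y p ->];
   rewrite ?map_cat.
Qed.

Lemma atoms_rename p : atoms (rename p) = map rename_atom (atoms p).
Proof. by elim: p => //= p -> q ->; rewrite map_cat. Qed.

(** Only an inclusion: for an arbitrary [f], a free variable may be sent to the image of a
    quantified one and be captured. *)
Lemma free_vars_rename p :
  {subset free_vars (rename p) <= map f (free_vars p)}.
Proof.
elim: p => //= [a|p IHp q IHq|p IHp q IHq|p IHp q IHq|y p IH|y p IH] x.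
- by rewrite atom_vars_rename.
1-3: by rewrite map_cat !mem_cat => /orP[/IHp|/IHq] ->; rewrite ?orbT.
all: rewrite mem_filter => /andP[ne /IH /mapP[z zp xz]]; apply/mapP; exists z => //;
  by rewrite mem_filter zp andbT; apply: contraNneq ne => <-; apply/eqP.
Qed.

Lemma cooccur_rename p x y :
  cooccur p x y -> cooccur (rename p) (f x) (f y).
Proof.
rewrite /cooccur atoms_rename has_map; apply: sub_has => a /andP[xa ya] /=.
by rewrite atom_vars_rename !map_f.
Qed.

Section Sat.
Variables (M : structure L).

Lemma eval_rename (rho rho' : nat -> M) t :
  {in term_vars t, forall x, rho' (f x) = rho x} ->
  eval rho' (rename_term t) = eval rho t.
Proof.
elim: t => [x|g args IH] /= H; first by apply: H; rewrite mem_head.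
congr fun_interp; apply: eq_mktuple => i; apply: IH => x xi; apply: H.
by apply/flatten_mapP; exists i; rewrite ?mem_enum.
Qed.

(** Injectivity on all variables of [p] excludes capture. *)
Lemma sat_rename p (rho rho' : nat -> M) :
  {in vars p &, injective f} ->
  {in free_vars p, forall x, rho' (f x) = rho x} ->
  sat rho' (rename p) <-> sat rho p.
Proof.
elim: p rho rho' => [a|p IH|p IHp q IHq|p IHp q IHq|p IHp q IHq|y p IH|y p IH]
  rho rho' /= inj H.
- case: a H {inj} => [h s t|R args] /= H.
    by rewrite (@eval_rename rho rho' s) ?(@eval_rename rho rho' t) // => x Hx;
      apply: H; rewrite mem_cat Hx ?orbT.
  suff -> : [tuple eval rho' (rename_term (args i)) | i < rel_arity R]
          = [tuple eval rho (args i) | i < rel_arity R] by [].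
  apply: eq_mktuple => i; apply: eval_rename => x xi; apply: H.
  by apply/flatten_mapP; exists i; rewrite ?mem_enum.
- by rewrite (IH rho rho').
1-3: have inj_p : {in vars p &, injective f}
  by apply: sub_in2 inj => x; rewrite /vars /= !mem_cat => /orP[] ->;
     rewrite ?orbT.
1-3: have inj_q : {in vars q &, injective f}
  by apply: sub_in2 inj => x; rewrite /vars /= !mem_cat => /orP[] ->;
     rewrite ?orbT.
1-3: have Hp : sat rho' (rename p) <-> sat rho p
  by apply: IHp => // x xp; apply: H; rewrite mem_cat xp.
1-3: have Hq : sat rho' (rename q) <-> sat rho q
  by apply: IHq => // x xq; apply: H; rewrite mem_cat xq orbT.
1-3: by rewrite Hp Hq.
all: have inj' : {in y :: vars p &, injective f}
  by apply: sub_in2 inj => x; rewrite !(inE, mem_cat, mem_filter);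
     case: eqVneq => //= _ ; rewrite ?orbT.
(* The updated assignments still correspond: at [y] both give [m], and any other [x] has [f x]
   different from [f y]. *)
all: have Hm m : sat (update rho' (f y) m) (rename p) <-> sat (update rho y m) p
  by apply: IH => [|x xp]; [by apply: sub_in2 inj' => x; rewrite inE orbC => ->|];
     rewrite /update; case: (eqVneq x y) => [->|ne]; rewrite ?eqxx //;
     rewrite ifN ?H ?mem_filter ?ne //; apply: contraNneq ne => exy;
     apply/eqP; apply: inj' => //; rewrite !(inE, mem_cat) ?eqxx ?xp ?orbT.
- by split=> H' m; apply/Hm.
- by split=> -[m H']; exists m; apply/Hm.
Qed.

(** Injectivity on each colour is enough, although [f] may identify variables of different colours:
    each monochrome piece is renamed without capture. The pieces are joined by [And] and [Or] only,
    and their free variables are uncoloured, hence fixed. *)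
Lemma sat_rename_disj (T : eqType) (colour : nat -> option T) p (rho : nat -> M) :
  disj_form colour p ->
  (forall k, {in [pred x | (colour x == None) || (colour x == Some k)] &,
     injective f}) ->
  (forall x, colour x = None -> f x = x) ->
  {in free_vars p, forall x, colour x = None} ->
  sat rho (rename p) <-> sat rho p.
Proof.
move=> dp inj fix_f.
elim: dp => {p} [p cp|p q _ IHp _ IHq] H; last first.
  by rewrite /= IHp ?IHq // => x xp; apply: H; rewrite mem_cat xp ?orbT.
elim: cp H => {p} [k p mp|p q _ IHp _ IHq] H; last first.
  by rewrite /= IHp ?IHq // => x xp; apply: H; rewrite mem_cat xp ?orbT.
apply: sat_rename => [|x /H /fix_f -> //].
by apply: sub_in2 (inj k) => x /mp [] cx; rewrite inE cx eqxx ?orbT.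
Qed.

End Sat.
End Renaming.

(** * Components as colours and the transfer into one component *)

Lemma atom_var_free_or_bound (L : language) (p : formula L) x y :
  cooccur p x y -> (x \in free_vars p) || (x \in bound_vars p).
Proof.
rewrite /cooccur.
elim: p => //= [a|p IHp q IHq|p IHp q IHq|p IHp q IHq|z p IH|z p IH].
- by case/orP=> // /andP[->].
1-3: by rewrite has_cat !mem_cat => /orP[/IHp|/IHq] /orP[] ->; rewrite ?orbT.
all: by rewrite mem_filter inE => /IH /orP[] ->; case: eqP; rewrite ?orbT.
Qed.

Lemma cooccurC (L : language) (p : formula L) x y :
  cooccur p x y = cooccur p y x.
Proof. by rewrite /cooccur; apply: eq_has => a; rewrite andbC. Qed.

Section Component.
Variables (L : language) (phi : formula L).
Notation V := (Delta_vertex phi).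

Definition component (u : V) : {set V} := [set v | connect (@Delta_edge L phi) u v].

Lemma Delta_connect_sym : connect_sym (@Delta_edge L phi).
Proof.
apply: sym_connect_sym => u v.
by rewrite /Delta_edge eq_sym -![has _ _]/(cooccur _ _ _) cooccurC.
Qed.

Lemma component_eqP u v : (component u == component v) = connect (@Delta_edge L phi) u v.
Proof.
apply/eqP/idP => [E|uv].
  have: v \in component u by rewrite E inE connect0.
  by rewrite inE.
by apply/setP => w; rewrite !inE (same_connect Delta_connect_sym uv).
Qed.

Lemma Delta_componentsE : Delta_components phi = [set component u | u : V].
Proof.
rewrite /Delta_components /equivalence_partition.
apply/setP => A; apply/imsetP/imsetP => -[u _ ->]; exists u => //;
  by apply/setP => v; rewrite !inE.
Qed.

Lemma component_in u : component u \in Delta_components phi.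
Proof. by rewrite Delta_componentsE imset_f. Qed.

Definition colour (x : nat) : option {set V} := omap component (insub x).

(* Sends the variables of each component into [C], preserving their rank; this
   is injective on the components that are not larger than [C]. *)
Definition transfer (C : {set V}) (x : nat) : nat :=
  if insub x is Some u
  then val (nth u (enum C) (index u (enum (component u)))) else x.

Lemma colour_None x : (colour x == None) = (x \notin bound_vars phi).
Proof. by rewrite /colour; case: insubP => [u -> _|->]. Qed.

Lemma colour_val (u : V) : colour (val u) = Some (component u).
Proof. by rewrite /colour valK. Qed.

Lemma transfer_None C x : colour x = None -> transfer C x = x.
Proof. by rewrite /colour /transfer; case: insub. Qed.

Lemma component_index u : index u (enum (component u)) < #|component u|.
Proof. by rewrite cardE index_mem mem_enum inE connect0. Qed.

Lemma transfer_val (C : {set V}) u : #|component u| <= #|C| ->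
  exists2 v, v \in C & transfer C (val u) = val v.
Proof.
move=> le_uC; rewrite /transfer valK; eexists; last by [].
by rewrite -mem_enum mem_nth // -cardE (leq_trans (component_index u)).
Qed.

(** Source and target enumerations coincide here, so looking up the rank of [v] returns [v]. *)
Lemma transfer_id u v : v \in component u -> transfer (component u) (val v) = val v.
Proof.
rewrite inE -component_eqP => /eqP ->.
by rewrite /transfer valK nth_index // mem_enum inE connect0.
Qed.

(** Within one component, ranks are distinct and all lie below the size of [C]. Uncoloured variables
    are fixed, and cannot meet an image of a bound variable, which is again bound. *)
Lemma transfer_inj (C : {set V}) (k : {set V}) :
  (forall u, #|component u| <= #|C|) ->
  {in [pred x | (colour x == None) || (colour x == Some k)] &,
     injective (transfer C)}.
Proof.
move=> le_C.
have bound x : x \in bound_vars phi -> transfer C x \in bound_vars phi.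
  move=> xB; have [v _ E] := @transfer_val C (SeqSub xB) (le_C _).
  by rewrite -[x]/(val (SeqSub xB)) E; apply: valP.
have unbound x : x \notin bound_vars phi -> transfer C x = x.
  by rewrite -colour_None => /eqP/transfer_None.
move=> x y; rewrite !inE !colour_None.
case: (boolP (x \in _)) (bound x) (unbound x) => /= xB x_bound ux;
  case: (boolP (y \in _)) (bound y) (unbound y) => /= yB y_bound uy.
- rewrite -[x]/(val (SeqSub xB)) -[y]/(val (SeqSub yB)) !colour_val.
  set u := SeqSub xB; set v := SeqSub yB.
  move=> /eqP[uk] /eqP[vk]; rewrite /transfer !valK uk vk => /val_inj E.
  congr val; apply/eqP.
  have ltu : index u (enum k) < size (enum C).
    by rewrite -cardE (leq_trans _ (le_C u)) // -{1}uk component_index.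
  have ltv : index v (enum k) < size (enum C).
    by rewrite -cardE (leq_trans _ (le_C v)) // -{1}vk component_index.
  (* In [transfer] each vertex is its own default for [nth]; the defaults are made equal, which is
     harmless as the indices are in range. *)
  rewrite (set_nth_default v) // in E.
  move/eqP: E; rewrite nth_uniq ?enum_uniq // => /eqP E.
  have uin : u \in enum k by rewrite mem_enum -uk inE connect0.
  have vin : v \in enum k by rewrite mem_enum -vk inE connect0.
  by rewrite -(nth_index v uin) E nth_index.
- by move=> _ _ E; move: (x_bound isT); rewrite E uy // (negPf yB).
- by move=> _ _ E; move: (y_bound isT); rewrite -E ux // (negPf xB).
- by rewrite ux // uy.
Qed.

(** Two bound variables of one atom are equal or adjacent, hence of the same component. The vertex
    [u] supplies the default colour. *)
Lemma separable_colour (u : V) : separable colour phi.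
Proof.
apply: (@separableP _ _ _ (component u)) => [x|x y xy].
  by rewrite colour_None negbK.
rewrite !colour_None !negbK => xB yB.
rewrite -[x]/(val (SeqSub xB)) -[y]/(val (SeqSub yB)) !colour_val.
congr Some; apply/eqP; rewrite component_eqP.
case: (eqVneq (SeqSub xB : V) (SeqSub yB)) => [->//|ne].
by apply: connect1; rewrite /Delta_edge ne; exact: xy.
Qed.

End Component.

(** * Connectedness and size of the new graph *)

(** A path of [phi] inside the component of [u0] is followed edge by edge in [psi]. *)
Lemma Delta_connected_intro (L : language) (phi psi : formula L)
    (u0 : Delta_vertex phi) :
  {subset free_vars psi <= free_vars phi} ->
  free_bound_disjoint phi ->
  {in bound_vars psi, forall x, exists2 u, u \in component u0 & val u = x} ->
  {in component u0 &, forall u v, cooccur phi (val u) (val v) ->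
     cooccur psi (val u) (val v)} ->
  Delta_connected psi.
Proof.
move=> sub_free disj bound co u v.
have [u' u'C uu'] := bound _ (valP u); have [v' v'C vv'] := bound _ (valP v).
have : connect (@Delta_edge L phi) u' v'.
  by rewrite -component_eqP; move: u'C v'C; rewrite !inE -!component_eqP => /eqP<- /eqP<-.
case/connectP=> s; elim: s u u' u'C uu' => [|w s IH] u u' u'C uu' /=.
  by move=> _ E; rewrite E uu' in vv'; rewrite (val_inj vv') connect0.
case/andP=> u'w ps last_s.
have wC : w \in component u0.
  move: u'C; rewrite !inE => u0u'.
  exact: connect_trans u0u' (connect1 u'w).
have [ne u'w_co] := andP u'w.
have co_psi : cooccur psi (val u') (val w) by apply: co.
(* The next point of the path is a vertex of [psi]: it occurs in an atom of [psi], and it is not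
   free there, being bound in [phi]. *)
have wB : val w \in bound_vars psi.
  have := co_psi; rewrite cooccurC => /atom_var_free_or_bound.
  case/orP=> // /sub_free /disj; by rewrite (valP w).
apply: connect_trans (IH (SeqSub wB) w wC erefl ps last_s).
apply: connect1; rewrite /Delta_edge -val_eqE /= -uu' val_eqE ne.
exact: co_psi.
Qed.

Theorem mainTheorem10 (L : language) (phi : formula L)
    (hphi : free_bound_disjoint phi) :
  exists phi' : formula L,
    [/\ equivalent phi phi',
        {subset free_vars phi' <= free_vars phi},
        free_bound_disjoint phi',
        Delta_connected phi' &
        #|Delta_vertex phi'| <= \max_(C in Delta_components phi) #|C|].
Proof.
case: (pickP (fun _ : Delta_vertex phi => true)) => [w _|noV]; last first.
  (* Without quantifiers, [phi] itself has the empty graph. *)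
  by exists phi; split=> // [u|]; [have := noV u | rewrite eq_card0].
have [|C0 C0in maxC0] := @eq_bigmax_cond _ [in Delta_components phi] (fun C => #|C|).
  by apply/card_gt0P; exists (component w); apply: component_in.
have [u0 C0E] : exists u0, C0 = component u0.
  by move: C0in; rewrite Delta_componentsE => /imsetP[u0 _ ->]; exists u0.
have le_C0 (u : Delta_vertex phi) : #|component u| <= #|C0|.
  by rewrite -maxC0; apply: leq_bigmax_cond; apply: component_in.
have [psi [eq_psi free_psi bound_psi co_psi] disj_psi] := separable_colour w.
pose f := transfer C0; exists (rename f psi).
have free_None x : x \in free_vars psi -> colour phi x = None.
  by move=> /free_psi /hphi; rewrite -colour_None => /eqP.
have sub_free : {subset free_vars (rename f psi) <= free_vars phi}.
  move=> x /free_vars_rename /mapP[z zp ->].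
  by rewrite /f transfer_None ?free_None //; apply: free_psi.
have bound x : x \in bound_vars (rename f psi) ->
    exists2 u, u \in C0 & val u = x.
  rewrite bound_vars_rename => /mapP[z /bound_psi zB ->].
  by have [v vC] := transfer_val (le_C0 (SeqSub zB)); exists v.
split=> //.
- move=> M rho; rewrite (eq_psi M rho); symmetry.
  apply: (sat_rename_disj rho disj_psi) => // [k|]; first exact: transfer_inj.
  exact: transfer_None.
- move=> x /sub_free /hphi xB; apply/negP => /bound[u _ ux].
  by rewrite -ux (valP u) in xB.
- apply: (@Delta_connected_intro _ phi _ u0) => // [x /bound|u v uC vC].
    by rewrite C0E.
  (* Edges inside [C0] survive in [psi], and the renaming fixes their endpoints. *)
  move/co_psi/(cooccur_rename f); rewrite /f C0E.
  by rewrite !transfer_id.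
- rewrite maxC0.
  (* The new vertices embed into [C0] as the same symbols; the default [w] is never reached. *)
  pose h (u : Delta_vertex (rename f psi)) : Delta_vertex phi := insubd w (val u).
  have hE u : h u \in C0 /\ val (h u) = val u.
    by have [v vC vu] := bound _ (valP u); rewrite /h -vu valKd.
  have h_inj : injective h.
    by move=> u v huv; apply: val_inj; rewrite -(hE u).2 -(hE v).2 huv.
  rewrite -(card_imset _ h_inj); apply: subset_leq_card.
  by apply/subsetP => _ /imsetP[u _ ->]; have [] := hE u.
Qed.
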